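(* Under the correspondence $S\mapsto{\mathcal C}(S)$ between cat-semigroups and categories with biaction, with inverse $C\mapsto(C,\otimes_l,D,R)$, the left semi-localisable semigroups correspond exactly to the categories with biaction satisfying (TC3), (TC4L) and (TC5a). That is: if $S$ is a left semi-localisable semigroup then ${\mathcal C}(S)$ is a category with biaction satisfying (TC3), (TC4L) and (TC5a), and the left pseudoproduct on ${\mathcal C}(S)$ is the multiplication of $S$; and conversely, if $C$ is a category with biaction satisfying (TC3), (TC4L) and (TC5a), then the left pseudoproduct $\otimes_l$ is defined on all of $C$, $(C,\otimes_l,D,R)$ is a left semi-localisable semigroup, and ${\mathcal C}(C,\otimes_l,D,R)=C$ as categories with biaction.
   Context: Biunary semigroups. A precat-semigroup is a semigroup $S$ with two unary operations $D,R$ such that for all $x\in S$: $D(x)x=x$, $xR(x)=x$, $D(x)^2=D(x)$, $D(R(x))=R(x)$, $R(D(x))=D(x)$. Put $D(S)=\{D(s)\mid s\in S\}$. A cat-semigroup is a precat-semigroup such that for all $x,y$, $R(x)=D(y)$ implies $D(xy)=D(x)$ and $R(xy)=R(y)$. A left semi-localisable semigroup is a precat-semigroup satisfying the left congruence condition $D(xy)=D(xD(y))$ and the right weak congruence condition $R(xy)=R(R(xD(y))y)$, and in which $D(S)$ is a band (i.e. closed under multiplication). (Every such semigroup is a cat-semigroup.) Categories. A (small) category is a set $C$ with a partial binary operation $\circ$ and unary operations $D,R$ such that for all $x,y,z\in C$: $D(x)\circ x=x$ and $x\circ R(x)=x$; $R(D(x))=D(x)$ and $D(R(x))=R(x)$;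 $x\circ y$ exists if and only if $R(x)=D(y)$; if $R(x)=D(y)$ then $D(x\circ y)=D(x)$ and $R(x\circ y)=R(y)$; $x\circ(y\circ z)=(x\circ y)\circ z$ whenever the two products are defined. Its set of identities is $C^0=\{D(s)\mid s\in C\}$. A category with biaction is a category $C$ equipped with everywhere-defined operations $C^0\times C\to C$, $(e,s)\mapsto e|s$ and $C\times C^0\to C$, $(s,e)\mapsto s|e$ such that: (TC1) for $e,f\in C^0$, $e|f$ is the same whether interpreted via the left or the right action; (TC2) $D(a)|a=a$ and $a|R(a)=a$ for all $a\in C$; (TC6) $(e|a)|f=e|(a|f)$ for all $e,f\in C^0$, $a\in C$. Conditions on a category with biaction $C$: (TC3) For all $a\in C$ and $e,f\in C^0$, $e|(f|a)=(e|f)|a$ and $a|(e|f)=(a|e)|f$ (this makes sense since (TC5a) implies $e|f\in C^0$). (TC4a) For all $a,b\in C$, if $a\circ b$ exists then for all $e\in C^0$ so does $(e|a)\circ(R(e|a)|b)$, and $e|(a\circ b)=(e|a)\circ(R(e|a)|b)$. (TC4b$'$) For all $a,b\in C$, if $a\circ b$ exists then for all $e\in C^0$ so does $(a|D(b|e))\circ\big(R(a|D(b|e))|(b|e)\big)$, and it equals $(a\circ b)|e$. (TC4L) means (TC4a) together with (TC4b$'$). (TC5a) For all $e\in C^0$ and $a\in C$, $D(e|a)=e|D(a)$. The left pseudoproduct is $s\otimes_l t=(s|D(t))\circ(R(s|D(t))|t)$; it is defined on all of $C$ exactly when $R(s|D(t))=D(R(s|D(t))|t)$ for all $s,t\in C$.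 For a cat-semigroup $S$, ${\mathcal C}(S)=(S,\circ,D,R)$ where $s\circ t=st$ if $R(s)=D(t)$ and is undefined otherwise; it is a category with ${\mathcal C}(S)^0=D(S)$, and a category with biaction under $e|s=es$, $s|e=se$ for $e\in D(S)$, $s\in S$. *)

(* Defs.v *)
From mathcomp Require Import all_boot.
From mathcomp Require Import boolp.

Set Implicit Arguments.
Unset Strict Implicit.
Unset Printing Implicit Defensive.

(* Every structure is carried by an arbitrary, possibly empty, type T. *)

Record biunary (T : Type) := Biunary {
  bmul : T -> T -> T;
  bD : T -> T;
  bR : T -> T }.

Record precat_semigroup (T : Type) (S : biunary T) : Prop := {
  precat_mulA : associative (bmul S);
  precat_mulDx : forall x, bmul S (bD S x) x = x;
  precat_mulxR : forall x, bmul S x (bR S x) = x;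
  precat_DD : forall x, bmul S (bD S x) (bD S x) = bD S x;
  precat_DR : forall x, bD S (bR S x) = bR S x;
  precat_RD : forall x, bR S (bD S x) = bD S x }.

Record cat_semigroup (T : Type) (S : biunary T) : Prop := {
  cats_precat : precat_semigroup S;
  cats_D : forall x y, bR S x = bD S y -> bD S (bmul S x y) = bD S x;
  cats_R : forall x y, bR S x = bD S y -> bR S (bmul S x y) = bR S y }.

Record left_semilocalisable (T : Type) (S : biunary T) : Prop := {
  lsl_precat : precat_semigroup S;
  lsl_left_cong : forall x y, bD S (bmul S x y) = bD S (bmul S x (bD S y));
  lsl_right_weak_cong : forall x y,
    bR S (bmul S x y) = bR S (bmul S (bR S (bmul S x (bD S y))) y);
  lsl_band : forall x y, exists z, bmul S (bD S x) (bD S y) = bD S z }.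

Lemma lsl_cat (T : Type) (S : biunary T) :
  left_semilocalisable S -> cat_semigroup S.
Proof.
case=> hp hD hR _; split=> // x y e.
- by rewrite hD -e (precat_mulxR hp).
- by rewrite hR -e (precat_mulxR hp) e (precat_mulDx hp).
Qed.

(* One-sorted small categories: the partial composition is option-valued, with
   [None] meaning undefined, and is written in diagrammatic order. *)
Record category (T : Type) := Category {
  comp : T -> T -> option T;
  cD : T -> T;
  cR : T -> T;
  comp_Dx : forall x, comp (cD x) x = Some x;
  comp_xR : forall x, comp x (cR x) = Some x;
  cRD : forall x, cR (cD x) = cD x;
  cDR : forall x, cD (cR x) = cR x;
  comp_exists : forall x y, (exists z, comp x y = Some z) <-> cR x = cD y;
  cD_comp : forall x y z, comp x y = Some z -> cD z = cD x;
  cR_comp : forall x y z, comp x y = Some z -> cR z = cR y;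
  compA : forall x y z xy yz u v,
    comp y z = Some yz -> comp x yz = Some u ->
    comp x y = Some xy -> comp xy z = Some v -> u = v }.

Definition cid (T : Type) (C : category T) := {e : T | exists s, cD C s = e}.

Definition cid_val (T : Type) (C : category T) (e : cid C) : T := sval e.

Definition Did (T : Type) (C : category T) (x : T) : cid C :=
  exist _ (cD C x) (ex_intro _ x erefl).

Definition Rid (T : Type) (C : category T) (x : T) : cid C :=
  exist _ (cR C x) (ex_intro _ (cR C x) (cDR C x)).

Record cat_biaction (T : Type) := CatBiaction {
  bcat :> category T;
  lact : cid bcat -> T -> T;
  ract : T -> cid bcat -> T;
  TC1 : forall e f : cid bcat, lact e (cid_val f) = ract (cid_val e) f;
  TC2l : forall a, lact (Did bcat a) a = a;
  TC2r : forall a, ract a (Rid bcat a) = a;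
  TC6 : forall (e f : cid bcat) a, ract (lact e a) f = lact e (ract a f) }.

(* The element e|f acts as the identity g with underlying element e|f. Such a g
   is unique, and it exists as soon as TC5a holds, since then
   e|f = e|D(f) = D(e|f). *)
Definition TC3 (T : Type) (C : cat_biaction T) : Prop :=
  forall e f g : cid C, cid_val g = lact e (cid_val f) ->
  forall a, lact e (lact f a) = lact g a /\ ract a g = ract (ract a e) f.

Definition TC4a (T : Type) (C : cat_biaction T) : Prop :=
  forall a b ab, comp C a b = Some ab -> forall e : cid C,
  comp C (lact e a) (lact (Rid C (lact e a)) b) = Some (lact e ab).

Definition TC4b' (T : Type) (C : cat_biaction T) : Prop :=
  forall a b ab, comp C a b = Some ab -> forall e : cid C,
  let a' := ract a (Did C (ract b e)) in
  comp C a' (lact (Rid C a') (ract b e)) = Some (ract ab e).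

Definition TC4L (T : Type) (C : cat_biaction T) : Prop := TC4a C /\ TC4b' C.

Definition TC5a (T : Type) (C : cat_biaction T) : Prop :=
  forall (e : cid C) a, cD C (lact e a) = lact e (cD C a).

Definition lpprod (T : Type) (C : cat_biaction T) (s t : T) : option T :=
  let s' := ract s (Did C t) in comp C s' (lact (Rid C s') t).

Definition lpprod_total (T : Type) (C : cat_biaction T) : Prop :=
  forall s t, exists u, lpprod C s t = Some u.

(* (C, \otimes_l, D, R); the default value of [odflt] is irrelevant when
   [lpprod_total C] holds. *)
Definition lpprod_biunary (T : Type) (C : cat_biaction T) : biunary T :=
  Biunary (fun s t => odflt s (lpprod C s t)) (cD C) (cR C).

Section CategoryOfSemigroup.
Variables (T : Type) (S : biunary T) (hS : cat_semigroup S).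

Definition scomp (s t : T) : option T :=
  if `[< bR S s = bD S t >] then Some (bmul S s t) else None.

Lemma scompP s t u :
  scomp s t = Some u <-> bR S s = bD S t /\ bmul S s t = u.
Proof.
rewrite /scomp; case: asboolP => h; split=> //.
- by case.
- by case=> _ ->.
- by case.
Qed.

Let hp := cats_precat hS.

Fact scomp_Dx x : scomp (bD S x) x = Some x.
Proof. by apply/scompP; rewrite (precat_RD hp) (precat_mulDx hp). Qed.

Fact scomp_xR x : scomp x (bR S x) = Some x.
Proof. by apply/scompP; rewrite (precat_DR hp) (precat_mulxR hp). Qed.

Fact scomp_exists x y : (exists z, scomp x y = Some z) <-> bR S x = bD S y.
Proof.
split=> [[z /scompP[]] //|h].
by exists (bmul S x y); apply/scompP.
Qed.

Fact scomp_D x y z : scomp x y = Some z -> bD S z = bD S x.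
Proof. by move/scompP=> [h <-]; apply: cats_D hS _ _ h. Qed.

Fact scomp_R x y z : scomp x y = Some z -> bR S z = bR S y.
Proof. by move/scompP=> [h <-]; apply: cats_R hS _ _ h. Qed.

Fact scompA x y z xy yz u v :
  scomp y z = Some yz -> scomp x yz = Some u ->
  scomp x y = Some xy -> scomp xy z = Some v -> u = v.
Proof.
move=> /scompP[_ <-] /scompP[_ <-] /scompP[_ <-] /scompP[_ <-].
exact: (precat_mulA hp).
Qed.

Definition scat : category T :=
  Category scomp_Dx scomp_xR (precat_RD hp) (precat_DR hp)
    scomp_exists scomp_D scomp_R scompA.

Definition slact (e : cid scat) (s : T) : T := bmul S (cid_val e) s.
Definition sract (s : T) (e : cid scat) : T := bmul S s (cid_val e).

Fact sTC6 (e f : cid scat) a : sract (slact e a) f = slact e (sract a f).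
Proof. exact/esym/(precat_mulA hp). Qed.

Definition cat_of_semigroup : cat_biaction T :=
  @CatBiaction T scat slact sract (fun _ _ => erefl)
    (precat_mulDx hp) (precat_mulxR hp) sTC6.

End CategoryOfSemigroup.

(* Main.v *)
Require Import Defs.
From mathcomp Require Import all_boot.
From mathcomp Require Import boolp.
(* [comp] is to mean composition in a category, not of functions. *)
Import Defs.

(** The two constructions are mutually inverse because the actions by
    identities and the multiplication determine each other: in a semigroup the
    actions are multiplications by elements of D(S), while the left
    pseudoproduct of a category, written s * t below, satisfies e * a = e|a and
    a * e = a|e for identities e ([identity_lmul], [lmul_identity]) and extends
    the composition ([lmul_comp]).

    From semigroups to categories, the required equations follow from
    associativity once the composites are known to exist.  Existence always
    reduces to R(xf)f = R(xf) with f in D(S) ([lsl_R_absorb]): the right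
    weak congruence condition for xf and f gives R(xf) = R(R(xf)f), and R is
    the identity map on the band D(S).

    From categories to semigroups, the counterpart R(a|e)|e = R(a|e)
    ([R_dractK]) comes from (TC4b') applied to the composite of a with R(a), and
    it makes the pseudoproduct total.  The main point is associativity
    ([lmulA]).  Condition (TC4b') gives (s * t)|e = s * (t|e) ([lmul_dract]).
    Let e = D(u), p = s|D(t|e) and q = R(p)|(t|e), so that (s * t)|e is the
    composite of p and q.  Then (s * t) * u is the composite of p, q and R(q)|u,
    bracketed to the left.  As t * u has domain D(t|e), the product s * (t * u)
    is the composite of p with R(p)|(t * u), and (TC4a) says that the latter is
    the composite of q and R(q)|u.  So associativity of the composition
    concludes. *)

Set Implicit Arguments.
Unset Strict Implicit.
Unset Printing Implicit Defensive.

(** * Identities and extensionality *)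

Section Identities.
Variables (T : Type) (C : category T).

Lemma cid_inj (e f : cid C) : cid_val e = cid_val f -> e = f.
Proof.
case: e f => [e he] [f hf] /= ef; subst f.
by congr exist; apply: Prop_irrelevance.
Qed.

Lemma cDD x : cD C (cD C x) = cD C x.
Proof. by rewrite -(cRD C x) cDR cRD. Qed.

Lemma cidE (e : cid C) : e = Did C (cid_val e).
Proof. by apply: cid_inj; case: e => e [s /= <-]; rewrite cDD. Qed.

Lemma RidE x : Rid C x = Did C (cR C x).
Proof. by apply: cid_inj; rewrite /= cDR. Qed.

Lemma Did_eq x y : cD C x = cD C y -> Did C x = Did C y.
Proof. by move=> xy; apply: cid_inj. Qed.

Lemma comp_defined x y : cR C x = cD C y -> exists z, comp C x y = Some z.
Proof. by move/comp_exists. Qed.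

Lemma comp_composable x y z : comp C x y = Some z -> cR C x = cD C y.
Proof. by move=> xyz; apply/comp_exists; exists z. Qed.

Lemma comp_assoc x y z xy yz :
  comp C x y = Some xy -> comp C y z = Some yz -> comp C xy z = comp C x yz.
Proof.
move=> xyE yzE.
have [v vE] : exists v, comp C xy z = Some v.
  by apply: comp_defined; rewrite (cR_comp xyE) (comp_composable yzE).
have [u uE] : exists u, comp C x yz = Some u.
  by apply: comp_defined; rewrite (cD_comp yzE) (comp_composable xyE).
by rewrite vE uE (compA yzE uE xyE vE).
Qed.

End Identities.

Lemma category_ext (T : Type) (C1 C2 : category T) :
  comp C1 =2 comp C2 -> cD C1 =1 cD C2 -> cR C1 =1 cR C2 -> C1 = C2.
Proof.
case: C1 => m1 D1 R1 a1 a2 a3 a4 a5 a6 a7 a8.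
case: C2 => m2 D2 R2 b1 b2 b3 b4 b5 b6 b7 b8 /= em eD eR.
have {}em : m1 = m2 by apply/funext => x; apply/funext.
move/funext: eD => eD; move/funext: eR => eR; subst m2 D2 R2.
by congr Category; apply: Prop_irrelevance.
Qed.

(** The identities of the two categories live in different types, so the actions
    are compared on identities with the same underlying element. *)
Lemma cat_biaction_ext (T : Type) (C1 C2 : cat_biaction T) :
  bcat C1 = bcat C2 ->
  (forall (e1 : cid C1) (e2 : cid C2) a,
     cid_val e1 = cid_val e2 -> lact e1 a = lact e2 a) ->
  (forall (e1 : cid C1) (e2 : cid C2) a,
     cid_val e1 = cid_val e2 -> ract a e1 = ract a e2) ->
  C1 = C2.
Proof.
case: C1 => c1 l1 r1 p1 p2 p3 p4; case: C2 => c2 l2 r2 q1 q2 q3 q4 /= ec.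
subst c2 => el er.
have {}el : l1 = l2 by apply/funext => e; apply/funext => a; apply: el.
have {}er : r1 = r2 by apply/funext => a; apply/funext => e; apply: er.
by subst l2 r2; congr CatBiaction; apply: Prop_irrelevance.
Qed.

(** * From semigroups to categories *)

Section SemigroupToCategory.
Variables (T : Type) (S : biunary T) (hS : left_semilocalisable S).

Local Notation "x * y" := (bmul S x y).
Local Notation D := (bD S).
Local Notation R := (bR S).
Local Notation C := (cat_of_semigroup (lsl_cat hS)).
Let hp := lsl_precat hS.

Lemma precat_DDx x : D (D x) = D x.
Proof. by rewrite -[D x](precat_RD hp) (precat_DR hp) (precat_RD hp). Qed.

Lemma lsl_D_band x y : D (D x * D y) = D x * D y.
Proof. by have [z ->] := lsl_band hS x y; rewrite precat_DDx. Qed.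

Lemma lsl_R_band x y : R (D x * D y) = D x * D y.
Proof. by have [z ->] := lsl_band hS x y; rewrite (precat_RD hp). Qed.

(** This guarantees that the composites in the biaction axioms and in the left
    pseudoproduct exist. *)
Lemma lsl_R_absorb x y : R (x * D y) * D y = R (x * D y).
Proof.
have := lsl_right_weak_cong hS (x * D y) (D y).
rewrite precat_DDx -!(precat_mulA hp) (precat_DD hp) => {2}->.
by rewrite -[R (x * D y)](precat_DR hp) lsl_R_band.
Qed.

Lemma lsl_D_mulDx x y : D (D x * y) = D x * D y.
Proof. by rewrite (lsl_left_cong hS) lsl_D_band. Qed.

Lemma lsl_comp_absorb x y : R x * D y = R x ->
  scomp S x (R x * y) = Some (x * y).
Proof.
move=> xy; apply/scompP; split.
  by rewrite -(precat_DR hp) lsl_D_mulDx (precat_DR hp).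
by rewrite (precat_mulA hp) (precat_mulxR hp).
Qed.

Lemma lsl_TC3 : TC3 C.
Proof.
move=> e f g /= gE a; rewrite /slact /sract gE /slact.
by rewrite !(precat_mulA hp).
Qed.

Lemma lsl_TC5a : TC5a C.
Proof.
move=> e a; rewrite /= /slact /cid_val; case: (svalP e) => s /= <-.
exact: lsl_D_mulDx.
Qed.

Lemma lsl_TC4a : TC4a C.
Proof.
move=> a b ab /scompP[RaDb <-] e; rewrite /= /slact /=.
rewrite (precat_mulA hp (cid_val e)); apply: lsl_comp_absorb.
(* [lsl_R_absorb] applies to [ea] because [ea = (ea)R(a)] and [R(a) = D(b)]. *)
by rewrite -RaDb -{1 3}(precat_mulxR hp a) (precat_mulA hp) RaDb lsl_R_absorb.
Qed.

Lemma lsl_TC4b' : TC4b' C.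
Proof.
move=> a b ab /scompP[RaDb <-] e; rewrite /= /slact /sract /=.
rewrite lsl_comp_absorb ?lsl_R_absorb //.
by rewrite -(precat_mulA hp a) (precat_mulDx hp) (precat_mulA hp).
Qed.

Lemma lsl_lpprod s t : lpprod C s t = Some (s * t).
Proof.
rewrite /lpprod /= /slact /sract /= lsl_comp_absorb ?lsl_R_absorb //.
by rewrite -(precat_mulA hp) (precat_mulDx hp).
Qed.

End SemigroupToCategory.

(** * From categories to semigroups *)

Section CategoryToSemigroup.
Variables (T : Type) (C : cat_biaction T).
Hypotheses (hTC3 : TC3 C) (hTC4a : TC4a C) (hTC4b' : TC4b' C) (hTC5a : TC5a C).

Local Notation D := (cD C).
Local Notation R := (cR C).

(** Letting every element act through its domain makes the actions operations
    on [T] and avoids carrying proofs that elements are identities. *)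
Definition dlact x a : T := lact (Did C x) a.
Definition dract a x : T := ract a (Did C x).

Local Notation "x |> a" := (dlact x a) (at level 40, left associativity).
Local Notation "a <| x" := (dract a x) (at level 40, left associativity).

Lemma lactE (e : cid C) a : lact e a = cid_val e |> a.
Proof. by rewrite {1}[e]cidE. Qed.

Lemma ractE a (e : cid C) : ract a e = a <| cid_val e.
Proof. by rewrite {1}[e]cidE. Qed.

Lemma dlactD x a : D x |> a = x |> a.
Proof. by rewrite /dlact (@Did_eq _ C (D x) x) ?cDD. Qed.

Lemma dractD a x : a <| D x = a <| x.
Proof. by rewrite /dract (@Did_eq _ C (D x) x) ?cDD. Qed.

Lemma dlact_dract x y : x |> D y = D x <| y.
Proof. exact: (TC1 (Did C x) (Did C y)). Qed.

Lemma dlact_id a : a |> a = a.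
Proof. exact: TC2l. Qed.

Lemma dract_R a : a <| R a = a.
Proof. by rewrite /dract -RidE TC2r. Qed.

Lemma dactA x a y : (x |> a) <| y = x |> (a <| y).
Proof. exact: TC6. Qed.

Lemma D_dlact x a : D (x |> a) = x |> D a.
Proof. exact: hTC5a. Qed.

Lemma dlactA x y a : x |> (y |> a) = (x |> y) |> a.
Proof.
have [] // := @hTC3 (Did C x) (Did C y) (Did C (x |> y)) _ a.
exact: D_dlact.
Qed.

Lemma dractA a x y : a <| (x |> y) = a <| x <| y.
Proof.
have [] // := @hTC3 (Did C x) (Did C y) (Did C (x |> y)) _ a.
exact: D_dlact.
Qed.

Lemma comp_dlact a b ab x : comp C a b = Some ab ->
  comp C (x |> a) (R (x |> a) |> b) = Some (x |> ab).
Proof. by move=> h; rewrite /dlact -RidE; apply: hTC4a. Qed.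

Lemma comp_dract a b ab x : comp C a b = Some ab ->
  let a' := a <| (b <| x) in
  comp C a' (R a' |> (b <| x)) = Some (ab <| x).
Proof. by move=> h a'; rewrite /dlact -RidE; apply: hTC4b'. Qed.

Lemma dractK a x : a <| x <| x = a <| x.
Proof. by rewrite -dractA dlact_id. Qed.

(** Acting on [a = a R(a)], condition (TC4a) yields a composite of [x|a] with an
    identity, so that identity must be R(x|a). *)
Lemma R_dlact x a : R (x |> a) |> R a = R (x |> a).
Proof.
by have := comp_composable (comp_dlact x (comp_xR C a)); rewrite D_dlact cDR.
Qed.

(** Since a|(R(a)|x) = a|x, acting on [a = a R(a)] with (TC4b') yields a
    composite of [a|x] with an identity, so that identity must be R(a|x). *)
Lemma R_dract a x : R (a <| x) |> R a <| x = R (a <| x).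
Proof.
have RaxE : R a <| x = R a |> D x by rewrite dlact_dract cDR.
have aRx : a <| (R a <| x) = a <| x.
  by rewrite RaxE dractA dract_R dractD.
have := comp_composable (comp_dract x (comp_xR C a)); rewrite /= aRx.
by rewrite D_dlact [X in D X]RaxE D_dlact cDD -RaxE -dactA.
Qed.

Lemma R_dractK a x : R (a <| x) <| x = R (a <| x).
Proof. by rewrite -R_dract dractK. Qed.

(** The identity R(a|x) lies below R(a), so acting by R(a) first is harmless;
    this collapses the double action produced by (TC4b') on a pseudoproduct. *)
Lemma R_dract_dlact a x : R (a <| x) |> (R a |> x) = R (a <| x) |> x.
Proof.
have DE : D (R (a <| x) |> R a |> x) = R (a <| x).
  by rewrite D_dlact dlact_dract D_dlact cDR R_dract.
by rewrite dlactA -{2}(dlact_id x) dlactA -dlactD DE.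
Qed.

Local Notation "s * t" := (bmul (lpprod_biunary C) s t).

Lemma lpprodE s t :
  lpprod C s t = comp C (s <| t) (R (s <| t) |> t).
Proof. by rewrite /lpprod /dlact -RidE. Qed.

Lemma lpprod_defined : lpprod_total C.
Proof.
move=> s t; rewrite lpprodE; apply: comp_defined.
by rewrite D_dlact dlact_dract cDR R_dractK.
Qed.

Lemma lmulE s t : comp C (s <| t) (R (s <| t) |> t) = Some (s * t).
Proof.
by have [u uE] := lpprod_defined s t; rewrite -lpprodE /= uE.
Qed.

Lemma D_lmul s t : D (s * t) = D (s <| t).
Proof. exact: cD_comp (lmulE s t). Qed.

Lemma R_lmul s t : R (s * t) = R (R (s <| t) |> t).
Proof. exact: cR_comp (lmulE s t). Qed.

Lemma lmul_comp s t u : comp C s t = Some u -> s * t = u.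
Proof.
move=> stu; have RsDt := comp_composable stu.
have sE : s <| t = s by rewrite -dractD -RsDt dract_R.
by have := lmulE s t; rewrite sE -dlactD cDR RsDt dlactD dlact_id stu => -[].
Qed.

Lemma lmul_identity s x : s * D x = s <| x.
Proof.
have := lmulE s (D x); rewrite dractD dlact_dract cDR R_dractK comp_xR.
by case.
Qed.

Lemma identity_lmul x t : D x * t = x |> t.
Proof.
have := lmulE (D x) t; rewrite -dlact_dract -D_dlact cRD dlactD.
have -> : (x |> t) |> t = x |> t.
  by rewrite -dlactD D_dlact -dlactA dlactD dlact_id.
by rewrite comp_Dx => -[].
Qed.

(** Acting on the right of a product only affects its second factor: this is the
    case of associativity in which the third factor is an identity. *)
Lemma lmul_dract s t x : (s * t) <| x = s * (t <| x).
Proof.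
set y := t <| x.
have yE : s <| t <| y = s <| y by rewrite -dractA /y -dactA dlact_id.
have := comp_dract x (lmulE s t); rewrite /= dactA -/y.
by rewrite dractA dract_R R_dract_dlact yE lmulE => -[].
Qed.

Lemma lmulA s t u : s * (t * u) = (s * t) * u.
Proof.
set p := s <| (t <| u); set q := R p |> (t <| u).
have pq : comp C p q = Some ((s * t) <| u) by rewrite lmul_dract lmulE.
have := lmulE (s * t) u; rewrite (cR_comp pq).
(* The domain of [t * u] is that of [t <| u], so [s] is restricted to [p]. *)
have pE : s <| (t * u) = p by rewrite -dractD D_lmul dractD.
have := comp_dlact (R p) (lmulE t u); rewrite -/q.
have -> : R q |> (R (t <| u) |> u) = R q |> u.
  by rewrite dlactA R_dlact.
move=> qu; rewrite (comp_assoc pq qu) => stuE.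
by have := lmulE s (t * u); rewrite pE stuE => -[].
Qed.

Lemma lmul_left_semilocalisable : left_semilocalisable (lpprod_biunary C).
Proof.
split; first split.
- exact: lmulA.
- by move=> x; apply: lmul_comp; rewrite comp_Dx.
- by move=> x; apply: lmul_comp; rewrite comp_xR.
- move=> x; change (D x * D x = D x).
  by rewrite identity_lmul -D_dlact dlact_id.
- exact: cDR.
- exact: cRD.
- move=> x y; change (D (x * y) = D (x * D y)).
  by rewrite lmul_identity D_lmul.
- move=> x y; change (R (x * y) = R (R (x * D y) * y)).
  by rewrite lmul_identity R_lmul -[R (x <| y) in RHS]cDR identity_lmul.
- move=> x y; exists (x |> y); change (D x * D y = D (x |> y)).
  by rewrite identity_lmul D_dlact.
Qed.

Lemma cat_of_lmul (hS : left_semilocalisable (lpprod_biunary C)) :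
  cat_of_semigroup (lsl_cat hS) = C.
Proof.
have idE (e : cid C) : cid_val e = D (cid_val e) by rewrite [e in LHS]cidE.
apply: cat_biaction_ext.
- apply: category_ext => // x y; rewrite [LHS]/(scomp _ x y) /scomp.
  case: asboolP => [xy|xy].
    have [u xyu] := comp_defined xy.
    by rewrite xyu (lmul_comp xyu).
  case xyE : (comp C x y) => [u|//].
  by case: xy; apply: comp_composable xyE.
- move=> e1 e2 a e12; change (cid_val e1 * a = lact e2 a).
  by rewrite e12 idE identity_lmul -lactE.
- move=> e1 e2 a e12; change (a * cid_val e1 = ract a e2).
  by rewrite e12 idE lmul_identity -ractE.
Qed.

End CategoryToSemigroup.

Theorem theorem4p11 (T : Type) :
  (forall (S : biunary T) (hS : left_semilocalisable S),
     let C := cat_of_semigroup (lsl_cat hS) in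
     [/\ TC3 C, TC4L C, TC5a C &
         forall s t : T, lpprod C s t = Some (bmul S s t)])
  /\
  (forall C : cat_biaction T, TC3 C -> TC4L C -> TC5a C ->
     lpprod_total C /\
     exists hS : left_semilocalisable (lpprod_biunary C),
       cat_of_semigroup (lsl_cat hS) = C).
Proof.
split=> [S hS C|C h3 [h4a h4b] h5a].
  split; [exact: lsl_TC3 | split; [exact: lsl_TC4a | exact: lsl_TC4b'] |
          exact: lsl_TC5a | exact: lsl_lpprod].
split; first exact: lpprod_defined.
have hS : left_semilocalisable (lpprod_biunary C).
  exact: lmul_left_semilocalisable.
by exists hS; apply: cat_of_lmul.
Qed.
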